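(* Let $A$ be an integral domain with fraction field $\mathcal{K}(A)$, and let $\operatorname{supp}:\operatorname{Spec}_rA\to\operatorname{Spec}A$, $\alpha\mapsto\operatorname{supp}(\alpha)=P_\alpha\cap -P_\alpha$, be the support map. Then the image $\operatorname{supp}(\operatorname{Spec}_cA)$ of the set of central orderings is the set of central prime ideals of $A$.
   Context: All rings are commutative and contain $\mathbb{Q}$. A cone of a ring $B$ is a subset $P\subset B$ with $P+P\subset P$, $P\cdot P\subset P$ and $b^2\in P$ for all $b\in B$; it is proper if $-1\notin P$. An ordering of $B$ is a proper cone $P$ such that $ab\in P$ implies $a\in P$ or $-b\in P$; $\operatorname{Spec}_rB$ is the set of orderings of $B$. For $\alpha\in\operatorname{Spec}_rA$, $P_\alpha$ is the corresponding cone; $a(\alpha)>0$ means $a\in P_\alpha\setminus\operatorname{supp}(\alpha)$. $\operatorname{Spec}_rA$ has the topology generated by the sets $\{\alpha\mid f_1(\alpha)>0,\ldots,f_k(\alpha)>0\}$, $f_i\in A$. The map $Q\mapsto Q\cap A$ identifies $\operatorname{Spec}_r\mathcal{K}(A)$ with the set of orderings of $A$ with support $(0)$; the set of central orderings is $\operatorname{Spec}_cA:=\overline{\operatorname{Spec}_r\mathcal{K}(A)}$ (closure in $\operatorname{Spec}_rA$). An ideal $I$ of $A$ is central if $a\in A$, $p\in A\cap\sum\mathcal{K}(A)^2$ and $a^2+p\in I$ imply $a\in I$, where $\sum\mathcal{K}(A)^2$ is the set of sums of squares in $\mathcal{K}(A)$. *)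

(* Defs.v *)
From HB Require Import structures.
From mathcomp Require Import all_boot all_order all_algebra.
From mathcomp Require Import finmap all_classical topology.

Set Implicit Arguments.
Unset Strict Implicit.
Unset Printing Implicit Defensive.

Import GRing.Theory.
Local Open Scope classical_set_scope.
Local Open Scope ring_scope.

Section RealSpectrum.
Variable B : comNzRingType.
Implicit Types P : set B.

Definition is_cone P : Prop :=
  [/\ forall a b, P a -> P b -> P (a + b),
      forall a b, P a -> P b -> P (a * b) &
      forall b, P (b ^+ 2)].

Definition is_ordering P : Prop :=
  [/\ is_cone P, ~ P (- 1) & forall a b, P (a * b) -> P a \/ P (- b)].

Record Specr : Type := MkSpecr {
  cone_of : set B;
  cone_ofP : is_ordering cone_of }.

HB.instance Definition _ := gen_eqMixin Specr.
HB.instance Definition _ := gen_choiceMixin Specr.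

(* Properness (1 \notin I) is part of idealr_closed. *)
Record Spec : Type := MkSpec {
  ideal_of : set B;
  ideal_ofP : idealr_closed [in ideal_of] /\ prime_idealr_closed [in ideal_of] }.

Definition supp_set P : set B := [set a | P a /\ P (- a)].

Lemma supp_set_prime P : is_ordering P ->
  idealr_closed [in supp_set P] /\ prime_idealr_closed [in supp_set P].
Proof.
move=> [[PD PM Psq] PN1 Pprime].
have Ptot a : P a \/ P (- a) by apply: Pprime; rewrite -expr2; apply: Psq.
have P0 : P 0 by have := Psq 0; rewrite expr2 mul0r.
split; first split.
- by rewrite inE /supp_set /= oppr0.
- by apply/negP; rewrite inE => -[].
- move=> a u v; rewrite !inE => -[Pu PNu] [Pv PNv]; split.
    apply: (PD) => //; have [Pa|PNa] := Ptot a; first exact: PM.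
    by rewrite -mulrNN; apply: PM.
  rewrite opprD; apply: (PD) => //; have [Pa|PNa] := Ptot a.
    by rewrite -mulrN; apply: PM.
  by rewrite -mulNr; apply: PM.
- move=> a b; rewrite inE => -[Pab PNab].
  have Pab' : P (a * - b) by rewrite mulrN.
  have PNab' : P (- a * b) by rewrite mulNr.
  have PNNab : P (- a * - b) by rewrite mulrNN.
  have := (Pprime _ _ Pab, Pprime _ _ Pab', Pprime _ _ PNab', Pprime _ _ PNNab).
  rewrite !opprK => -[[[H1 H2] H3] H4]; apply/orP; rewrite !inE /supp_set /=.
  tauto.
Qed.

Definition supp (alpha : Specr) : Spec :=
  MkSpec (supp_set_prime (cone_ofP alpha)).

(* [pos_at a alpha] is written a(alpha) > 0. *)
Definition pos_at (a : B) (alpha : Specr) : Prop :=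
  cone_of alpha a /\ ~ ideal_of (supp alpha) a.

Definition pos_open (fs : {fset B}) : set Specr :=
  [set alpha | forall f, f \in fs -> pos_at f alpha].

Lemma pos_open_cover : \bigcup_(fs in [set: {fset B}]) pos_open fs = setT.
Proof. by apply/seteqP; split=> // alpha _; exists fset0. Qed.

Lemma pos_open_join fs gs alpha : [set: {fset B}] fs -> [set: {fset B}] gs ->
  pos_open fs alpha -> pos_open gs alpha ->
  exists hs, [/\ [set: {fset B}] hs, pos_open hs alpha &
                 pos_open hs `<=` pos_open fs `&` pos_open gs].
Proof.
move=> _ _ fsa gsa; exists (fs `|` gs)%fset; split=> //.
  by move=> f /fsetUP[/fsa|/gsa].
by move=> beta H; split=> f fin; apply: H; rewrite inE fin ?orbT.
Qed.

HB.instance Definition _ :=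
  isBaseTopological.Build Specr pos_open_cover pos_open_join.

Definition sum_squares : set B :=
  [set x | exists s : seq B, x = \sum_(y <- s) y ^+ 2].

End RealSpectrum.

Lemma is_ordering_preimage (A B : comNzRingType) (f : {rmorphism A -> B})
  (Q : set B) : is_ordering Q -> is_ordering (f @^-1` Q).
Proof.
move=> [[QD QM Qsq] QN1 Qprime]; split; first split.
- by move=> a b Qa Qb; rewrite /preimage /= rmorphD; apply: QD.
- by move=> a b Qa Qb; rewrite /preimage /= rmorphM; apply: QM.
- by move=> b; rewrite /preimage /= rmorphXn; apply: Qsq.
- by rewrite /preimage /= rmorphN1.
- by move=> a b; rewrite /preimage /= rmorphM rmorphN; apply: Qprime.
Qed.

Section Central.
Variable A : idomainType.

(* Q |-> Q `&` A, with A embedded in {fraction A}. *)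
Definition Specr_frac (Q : Specr {fraction A}) : Specr A :=
  MkSpecr (is_ordering_preimage (@tofrac A) (cone_ofP Q)).

Definition Specc : set (Specr A) := closure (range Specr_frac).

Definition is_central (I : set A) : Prop :=
  forall a p : A, sum_squares (tofrac p) -> I (a ^+ 2 + p) -> I a.

End Central.

Arguments Specc : clear implicits.

(* Main.v *)
Require Import Defs.
From HB Require Import structures.
From mathcomp Require Import all_boot all_order all_algebra.
From mathcomp Require Import finmap all_classical topology.
From mathcomp Require Import ring.

Import GRing.Theory.

Local Open Scope classical_set_scope.
Local Open Scope ring_scope.

(** Write [K] for the fraction field of [A].

    Let [alpha] be a central ordering.  Every sum of squares [q] of [K] lying in
    [A] is nonnegative at [alpha], because it is nonnegative at all orderings
    of [K] and these are dense around [alpha].  If [a^2 + q] is in the support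
    of [alpha], then [a^2] and [- a^2 = q - (a^2 + q)] are both nonnegative at
    [alpha], so [a] is in the support.

    Conversely, let [p] be a central prime.  Being in the closure involves
    several inequalities at once, whereas the nonnegativity of the sums of
    squares of [K] lying in [A] only controls them one at a time.  So one looks
    for an ordering of [K] for which [p] is convex, and not just for an ordering
    of the residue field at [p].

    Call a cone [T] of [K] central for [p] when [p] satisfies the centrality
    condition with [T] instead of the sums of squares ([central_cone]).  Such cones are inductive, so there is a maximal one, [Q].
    The main point ([central_cone_adjoin]) is that, for every [f] in [K], [f] or
    [- f] can be adjoined to such a cone, so [Q] is total.  Indeed, up to scaling
    by squares, two failures are [x = c^2 + s + t f] and [y = c^2 + u - v f] with
    [x], [y] in [p], [c] not in [p] and [s], [t], [u], [v] in [T].  Eliminating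
    [f] gives [c^2 + e = w x + w' y], with [e] in [T] and nonnegative weights
    [w], [w'] of sum 1.  These weights are in [K] only, so this says nothing
    about [p] yet.  Squaring does: by convexity
    [x^2 + y^2 = c^4 + 2 c^2 e + e^2 + r] for some [r] in [T]; the left side is
    in [p], and centrality of [T] gives the contradiction [c] in [p].

    Centrality of [Q] makes [p] convex, so the set of the [a] such that [a + x]
    is in [Q] for some [x] in [p] is an ordering of [A] with support [p]
    ([supp_specialization], [specialization_ordering]).  Its positive elements
    already lie in [Q], so it is in the closure of the orderings of [K]
    ([specialization_central]). *)

(** * Cones and orderings *)

Section Cones.
Context {B : comNzRingType}.
Implicit Types (P T : set B) (a b f : B).

Lemma coneD {P} : is_cone P -> forall {a b}, P a -> P b -> P (a + b).
Proof. by case. Qed.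

Lemma coneM {P} : is_cone P -> forall {a b}, P a -> P b -> P (a * b).
Proof. by case. Qed.

Lemma cone_sqr {P} : is_cone P -> forall b, P (b ^+ 2).
Proof. by case. Qed.

Lemma cone0 {P} : is_cone P -> P 0.
Proof. by move=> cP; have := cone_sqr cP 0; rewrite expr0n. Qed.

Lemma cone1 {P} : is_cone P -> P 1.
Proof. by move=> cP; have := cone_sqr cP 1; rewrite expr1n. Qed.

Lemma ordering_total {P} : is_ordering P -> forall a, P a \/ P (- a).
Proof. by move=> [cP _ prP] a; apply: prP; rewrite -expr2; apply: cone_sqr. Qed.

Lemma sum_squares_sub_cone {P} : is_cone P -> @sum_squares B `<=` P.
Proof.
move=> cP _ [s ->]; elim: s => [|y s IHs]; first by rewrite big_nil; exact: cone0.
by rewrite big_cons; apply: coneD => //; apply: cone_sqr.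
Qed.

Lemma sum_squares_cone : is_cone (@sum_squares B).
Proof.
split.
- by move=> _ _ [s ->] [t ->]; exists (s ++ t); rewrite big_cat.
- move=> _ _ [s ->] [t ->]; exists [seq x * y | x <- s, y <- t].
  rewrite big_allpairs_dep big_distrl /=; apply: eq_bigr => x _.
  by rewrite big_distrr /=; apply: eq_bigr => y _; rewrite exprMn.
- by move=> b; exists [:: b]; rewrite big_seq1.
Qed.

(** The smallest cone containing the cone [T] and [f]: even powers of [f] are
    squares, so polynomials in [f] over [T] reduce to degree one. *)
Definition adjoin T f : set B :=
  [set x | exists s t, [/\ T s, T t & x = s + t * f]].

Lemma adjoin_cone {T} f : is_cone T -> is_cone (adjoin T f).
Proof.
move=> cT; split.
- move=> _ _ [s [t [Ts Tt ->]]] [u [v [Tu Tv ->]]].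
  by exists (s + u), (t + v); split; [exact: coneD|exact: coneD|ring].
- move=> _ _ [s [t [Ts Tt ->]]] [u [v [Tu Tv ->]]].
  exists (s * u + t * v * f ^+ 2), (s * v + t * u); split; last by ring.
    apply: (coneD cT); first exact: coneM.
    by apply: (coneM cT); [exact: coneM|exact: cone_sqr].
  by apply: (coneD cT); exact: coneM.
- move=> b; exists (b ^+ 2), 0.
  by split; [exact: cone_sqr|exact: cone0|ring].
Qed.

Lemma sub_adjoin {T} f : is_cone T -> T `<=` adjoin T f.
Proof. by move=> cT x Tx; exists x, 0; rewrite mul0r addr0; split=> //; exact: cone0. Qed.

Lemma mem_adjoin {T} f : is_cone T -> adjoin T f f.
Proof.
move=> cT; exists 0, 1; rewrite mul1r add0r.
by split=> //; [exact: cone0|exact: cone1].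
Qed.

End Cones.

Section FieldCones.
Context {F : fieldType}.
Implicit Types (T : set F) (c f s t u v w x y : F).

Lemma coneV {T} : is_cone T -> forall {x}, T x -> T x^-1.
Proof.
move=> cT x Tx; have [->|x0] := eqVneq x 0; first by rewrite invr0; exact: cone0.
have -> : x^-1 = x * x^-1 ^+ 2 by field.
by apply: coneM => //; exact: cone_sqr.
Qed.

Lemma proper_cone_anti {T} : is_cone T -> ~ T (- 1) ->
  forall {x}, T x -> T (- x) -> x = 0.
Proof.
move=> cT TN1 x Tx TNx; apply/eqP; apply/negPn/negP => x0; apply: TN1.
have -> : -1 = - x * x^-1 by field.
by apply: (coneM cT) => //; exact: coneV.
Qed.

Lemma total_cone_ordering {T} : is_cone T -> ~ T (- 1) ->
  (forall x, T x \/ T (- x)) -> is_ordering T.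
Proof.
move=> cT TN1 totT; split=> // x y Txy.
have [Tx|TNx] := totT x; first by left.
have [Ty|TNy] := totT y; last by right.
have /eqP : x * y = 0.
  by apply: (proper_cone_anti cT TN1) => //; rewrite -mulNr; exact: coneM.
rewrite mulf_eq0 => /orP[/eqP->|/eqP->]; [left|right].
  exact: cone0.
by rewrite oppr0; exact: cone0.
Qed.

(** With the weights [w = v / (v + t)] and [w' = t / (v + t)], the combination
    of [x = c^2 + s + t f] and [y = c^2 + u - v f] eliminates [f]:
    [w x + w' y = c^2 + e] where [e = w s + w' u] lies in [T].  The weights are
    nonnegative with sum 1, so convexity of the square bounds
    [(w x + w' y)^2] by [x^2 + y^2], and the bound involves no denominator. *)
Lemma cone_sqr_combination {T} : is_cone T -> forall c f s t u v,
  T s -> T t -> T u -> T v -> v + t != 0 ->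
  T ((c ^+ 2 + s + t * f) ^+ 2 + (c ^+ 2 + u - v * f) ^+ 2 - c ^+ 4).
Proof.
move=> cT c f s t u v Ts Tt Tu Tv vt0.
set x := c ^+ 2 + s + t * f; set y := c ^+ 2 + u - v * f.
have Tr := coneV cT (coneD cT Tv Tt); set r := (v + t)^-1 in Tr.
have Tw := coneM cT Tv Tr; have Tw' := coneM cT Tt Tr.
have Te := coneD cT (coneM cT Tw Ts) (coneM cT Tw' Tu).
set w := v * r in Tw Te; set w' := t * r in Tw' Te.
set e := w * s + w' * u in Te.
have -> : x ^+ 2 + y ^+ 2 - c ^+ 4 =
    (c ^+ 2 * e + c ^+ 2 * e + e ^+ 2)
    + (w' * x ^+ 2 + w * y ^+ 2 + w * w' * (x - y) ^+ 2).
  by rewrite /e /w /w' /r /x /y; field.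
have sqM z a : T a -> T (a * z ^+ 2).
  by move=> Ta; apply: (coneM cT) => //; exact: cone_sqr.
have Tce : T (c ^+ 2 * e) by rewrite mulrC; exact: sqM.
apply: (coneD cT); apply: (coneD cT).
- exact: coneD.
- exact: cone_sqr.
- by apply: (coneD cT); exact: sqM.
- by apply: sqM; exact: coneM.
Qed.

End FieldCones.

(** * The topology of the real spectrum *)

Lemma closure_pos_openP (B : comNzRingType) (S : set (Specr B)) alpha :
  closure S alpha <-> forall fs, pos_open fs alpha -> S `&` pos_open fs !=set0.
Proof.
split=> [clS fs fsa|H U]; first apply: clS.
  rewrite nbhsE; exists (pos_open fs) => //; split=> //.
  by exists [set fs] => //; rewrite bigcup_set1.
rewrite nbhsE => -[V [[D _ <-] [fs Dfs fsa]] VU].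
have [beta [Sb fsb]] := H fs fsa.
by exists beta; split=> //; apply: VU; exists fs.
Qed.

(** * Prime ideals *)

Section SpecTheory.
Context {A : idomainType}.
Implicit Types (p : Spec A) (a b : A).

Lemma spec_inj p p' : ideal_of p = ideal_of p' -> p = p'.
Proof.
case: p p' => [I HI] [J HJ] /= eIJ; case: _ / eIJ HJ => HJ.
by rewrite (Prop_irrelevance HI HJ).
Qed.

Lemma spec0 p : ideal_of p 0.
Proof. by case: p => I [[I0 _ _] _] /=; rewrite inE in I0. Qed.

Lemma spec1 p : ~ ideal_of p 1.
Proof. by case: p => I [[_ /negP I1 _] _] /= J1; apply: I1; rewrite inE. Qed.

Lemma specD {p a b} : ideal_of p a -> ideal_of p b -> ideal_of p (a + b).
Proof.
case: p => I [[_ _ IMD] _] /= Ia Ib.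
by have := IMD 1 a b; rewrite !inE mul1r; apply.
Qed.

Lemma specM {p} a {b} : ideal_of p b -> ideal_of p (a * b).
Proof.
case: p => I [[I0 _ IMD] _] /= Ib.
by have := IMD a b 0; rewrite !inE addr0 in I0 *; apply.
Qed.

Lemma specN {p a} : ideal_of p a -> ideal_of p (- a).
Proof. by rewrite -mulN1r; exact: specM. Qed.

Lemma spec_prime {p a b} : ideal_of p (a * b) -> ideal_of p a \/ ideal_of p b.
Proof.
case: p => I [_ Ipr] /= Iab.
by have := Ipr a b; rewrite !inE => /(_ Iab)/orP[]; rewrite inE; [left|right].
Qed.

Lemma spec_sqr {p a} : ideal_of p (a ^+ 2) -> ideal_of p a.
Proof. by rewrite expr2 => /spec_prime[]. Qed.

End SpecTheory.

(** * Supports of central orderings are central *)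

Section CentralSupport.
Context {A : idomainType}.
Implicit Types (alpha : Specr A) (a q : A).

Lemma ordering_frac_anti (Q : Specr {fraction A}) a :
  cone_of (Specr_frac Q) a -> cone_of (Specr_frac Q) (- a) -> a = 0.
Proof.
rewrite /= /preimage /= rmorphN; case: (cone_ofP Q) => cQ QN1 _ Qa QNa.
by apply/eqP; rewrite -tofrac_eq0 (proper_cone_anti cQ QN1 Qa QNa).
Qed.

(** If [q] were negative at [alpha], it would be so at some ordering of
    the fraction field by density; but sums of squares are nonnegative there. *)
Lemma central_sum_squares alpha q :
  Specc A alpha -> sum_squares (tofrac q) -> cone_of alpha q.
Proof.
move=> /closure_pos_openP cl sq; apply: contrapT => Nq.
have Pq : cone_of alpha (- q) by case: (ordering_total (cone_ofP alpha) q).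
have [|_ [[Q _ <-] Hpos]] := cl [fset (- q)%R]%fset.
  move=> f /fset1P ->; split=> //; case; by rewrite opprK.
have [Qq] := Hpos _ (fset11 _); apply; split=> //; rewrite opprK.
by apply: sum_squares_sub_cone sq; case: (cone_ofP Q).
Qed.

Lemma supp_central_is_central alpha :
  Specc A alpha -> is_central (ideal_of (supp alpha)).
Proof.
move=> ca a q sq aq; apply: spec_sqr.
have [cP _ _] := cone_ofP alpha.
split; first exact: cone_sqr.
have -> : - a ^+ 2 = - (a ^+ 2 + q) + q by ring.
by apply: (coneD cP); [case: aq|exact: central_sum_squares].
Qed.

End CentralSupport.

(** * Cones for which a prime ideal is central *)

Section CentralCones.
Context {A : idomainType}.
Variable p : Spec A.
Implicit Types (T : set {fraction A}) (f : {fraction A}) (a b q x : A).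

(** Centrality of [p], with an arbitrary cone of the fraction field in place
    of the sums of squares. *)
Definition central_cone T : Prop :=
  is_cone T /\
  forall a q, T (tofrac q) -> ideal_of p (a ^+ 2 + q) -> ideal_of p a.

Lemma central_coneN1 {T} : central_cone T -> ~ T (- 1).
Proof.
move=> [_ cen] TN1; apply: (spec1 p); apply: (cen 1 (- 1)).
  by rewrite rmorphN1.
by rewrite expr1n subrr; exact: spec0.
Qed.

Lemma not_central_cone {T} : is_cone T -> ~ central_cone T ->
  exists a q, [/\ T (tofrac q), ideal_of p (a ^+ 2 + q) & ~ ideal_of p a].
Proof.
move=> cT ncT; apply: contrapT => nex; apply: ncT; split=> // a q Tq paq.
by apply: contrapT => npa; apply: nex; exists a, q.
Qed.

(** Two failures of centrality, one for [f] and one for [- f], are scaled to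
    have the same square [c ^+ 2]; the combination that eliminates [f] is then
    a failure of centrality for [T] itself, at [c ^+ 2]. *)
Lemma central_cone_adjoin {T} f : central_cone T ->
  central_cone (adjoin T f) \/ central_cone (adjoin T (- f)).
Proof.
move=> cenT; have TN1 := central_coneN1 cenT; have [cT cen] := cenT.
apply: contrapT => /not_orP[nf nNf].
have [a [q [[s0 [t0 [Ts0 Tt0 eq]]] paq npa]]] :=
  not_central_cone (adjoin_cone f cT) nf.
have [b [q' [[u0 [v0 [Tu0 Tv0 eq']]] pbq npb]]] :=
  not_central_cone (adjoin_cone (- f) cT) nNf.
have npab : ~ ideal_of p (a * b) by move=> /spec_prime[].
have sqM (z w : {fraction A}) : T w -> T (z ^+ 2 * w).
  by move=> Tw; apply: (coneM cT) => //; exact: cone_sqr.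
set c := a * b in npab.
set x := c ^+ 2 + b ^+ 2 * q; set y := c ^+ 2 + a ^+ 2 * q'.
have px : ideal_of p x.
  have -> : x = b ^+ 2 * (a ^+ 2 + q) by rewrite /x /c; ring.
  exact: specM.
have py : ideal_of p y.
  have -> : y = a ^+ 2 * (b ^+ 2 + q') by rewrite /y /c; ring.
  exact: specM.
have Ts := sqM (tofrac b) _ Ts0; have Tt := sqM (tofrac b) _ Tt0.
have Tu := sqM (tofrac a) _ Tu0; have Tv := sqM (tofrac a) _ Tv0.
set s := _ * s0 in Ts; set t := _ * t0 in Tt.
set u := _ * u0 in Tu; set v := _ * v0 in Tv.
have ex : tofrac x = tofrac c ^+ 2 + s + t * f.
  by rewrite /x rmorphD rmorphM !rmorphXn /= eq /s /t; ring.
have ey : tofrac y = tofrac c ^+ 2 + u - v * f.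
  by rewrite /y rmorphD rmorphM !rmorphXn /= eq' /u /v; ring.
apply: npab; have [vt0|vt0] := eqVneq (v + t) 0.
  (* The weights are undefined, but [v] and [t] are opposite elements of a
     proper cone: [t] vanishes and [x] does not involve [f]. *)
  have t0E : t = 0.
    apply: (proper_cone_anti cT TN1) => //.
    by rewrite -[- t]add0r -vt0 addrK.
  apply: (cen c (x - c ^+ 2)); last by rewrite addrC subrK.
  by rewrite rmorphB rmorphXn /= ex t0E mul0r addr0 addrC addKr.
apply: spec_sqr; apply: (cen _ (x ^+ 2 + y ^+ 2 - c ^+ 4)).
  rewrite rmorphB rmorphD !rmorphXn /= ex ey.
  exact: cone_sqr_combination.
have -> : (c ^+ 2) ^+ 2 + (x ^+ 2 + y ^+ 2 - c ^+ 4) = x * x + y * y by ring.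
by apply: specD; exact: specM.
Qed.

Lemma central_cone_bigcup (F : set (set {fraction A})) : F !=set0 ->
  F `<=` central_cone -> total_on F subset -> central_cone (\bigcup_(X in F) X).
Proof.
move=> [X0 FX0] Fcen Ftot.
have join (x y : {fraction A}) : (\bigcup_(X in F) X) x -> (\bigcup_(X in F) X) y ->
    exists X, [/\ F X, X x & X y].
  move=> [X FX Xx] [Y FY Yy]; have [XY|YX] := Ftot _ _ FX FY.
    by exists Y; split=> //; apply: XY.
  by exists X; split=> //; apply: YX.
split; last by move=> a q [X FX Xq]; have [_] := Fcen _ FX; apply.
split.
- move=> x y /join Hx /Hx [X [FX Xx Xy]]; exists X => //.
  by have [cX _] := Fcen _ FX; exact: coneD.
- move=> x y /join Hx /Hx [X [FX Xx Xy]]; exists X => //.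
  by have [cX _] := Fcen _ FX; exact: coneM.
- by move=> x; exists X0 => //; have [cX _] := Fcen _ FX0; exact: cone_sqr.
Qed.

Lemma central_ordering_exists {T0} : central_cone T0 ->
  exists2 Q, is_ordering Q & central_cone Q.
Proof.
move=> cen0.
(* The empty set is allowed because it is the union of the empty chain. *)
have [|T [PT Tmax]] := @Zorn_bigcup _ (fun T => T = set0 \/ central_cone T).
  move=> F FP Ftot.
  have [[X [FX Xcen]]|none] := pselect (exists X, F X /\ central_cone X); last first.
    left; apply: bigcup0 => X FX; have [//|Xcen] := FP _ FX.
    by case: none; exists X.
  right; have -> : \bigcup_(Y in F) Y = \bigcup_(Y in F `&` central_cone) Y.
    apply/seteqP; split=> [x [Y FY Yx]|x [Y [FY _] Yx]]; exists Y => //.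
    by split=> //; have [Y0|//] := FP _ FY; rewrite Y0 in Yx.
  apply: central_cone_bigcup; [by exists X|by move=> Y []|].
  by move=> Y Z [FY _] [FZ _]; exact: Ftot.
have cenT : central_cone T.
  case: PT => // T0E; case: (Tmax T0); last by right.
  rewrite T0E; split=> [|/(_ 0 (cone0 cen0.1))//].
  exact: sub0set.
have [cT _] := cenT.
have grow g : central_cone (adjoin T g) -> T g.
  move=> ceng; apply: contrapT => nTg; apply: (Tmax (adjoin T g)); last by right.
  split; first exact: sub_adjoin.
  by move=> /(_ _ (mem_adjoin g cT)).
exists T => //; apply: total_cone_ordering => //; first exact: central_coneN1.
by move=> f; have [/grow|/grow] := central_cone_adjoin f cenT; [left|right].
Qed.

(** * Specializing an ordering to a convex prime ideal *)

Section Specialization.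
Variable Q : set {fraction A}.
Hypotheses (Qord : is_ordering Q) (Qcen : central_cone Q).

Let cQ : is_cone Q. Proof. by case: Qord. Qed.

Definition specialization : set A :=
  [set a | exists2 x, ideal_of p x & Q (tofrac (a + x))].

Lemma specialization_sub a : Q (tofrac a) -> specialization a.
Proof. by move=> Qa; exists 0; [exact: spec0|rewrite addr0]. Qed.

(** If [g = a + x] and [- g + z] lie in [Q] with [z] in [p], then multiplying
    the latter by [g] puts [g ^+ 2 + q] in [p] for some [q] in [Q]. *)
Lemma supp_specialization : supp_set specialization = ideal_of p.
Proof.
apply/seteqP; split=> [a [[x px Qx] [y py Qy]]|a pa]; last first.
  split; [exists (- a)|exists a] => //; first exact: specN.
    by rewrite subrr rmorph0; exact: cone0.
  by rewrite addNr rmorph0; exact: cone0.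
suff : ideal_of p (a + x) by move=> /specD/(_ (specN px)); rewrite addrK.
apply: (Qcen.2 _ ((a + x) * (- a + y))).
  by rewrite rmorphM; exact: coneM.
have -> : (a + x) ^+ 2 + (a + x) * (- a + y) = (a + x) * (x + y) by ring.
by apply: specM; exact: specD.
Qed.

Lemma specialization_ordering : is_ordering specialization.
Proof.
have cP : is_cone specialization.
  split.
  - move=> a b [x px Qx] [y py Qy]; exists (x + y); first exact: specD.
    by rewrite addrACA rmorphD; exact: coneD.
  - move=> a b [x px Qx] [y py Qy]; exists (a * y + (b + y) * x).
      by apply: specD; exact: specM.
    have -> : a * b + (a * y + (b + y) * x) = (a + x) * (b + y) by ring.
    by rewrite rmorphM; exact: coneM.
  - by move=> b; apply: specialization_sub; rewrite rmorphXn; exact: cone_sqr.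
have tot a : specialization a \/ specialization (- a).
  have [Qa|QNa] := ordering_total Qord (tofrac a); [left|right].
    exact: specialization_sub.
  by apply: specialization_sub; rewrite rmorphN.
split=> //.
  move=> PN1; apply: (spec1 p); rewrite -supp_specialization; split=> //.
  exact: cone1.
move=> a b Pab; have [Pa|PNa] := tot a; first by left.
have [Pb|PNb] := tot b; last by right.
have : ideal_of p (a * b).
  rewrite -supp_specialization; split=> //.
  by rewrite -mulNr; exact: coneM.
by move=> /spec_prime[]; rewrite -supp_specialization; case; [left|right].
Qed.

(** An element [f] positive at the specialization lies in [Q], so every basic
    neighbourhood of the specialization contains [Q] itself. *)
Lemma specialization_central : Specc A (MkSpecr specialization_ordering).
Proof.
apply/closure_pos_openP => fs fsP.
exists (Specr_frac (MkSpecr Qord)); split; first by exists (MkSpecr Qord).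
move=> f /fsP [/= Pf nsf].
have Qf : Q (tofrac f).
  have [//|QNf] := ordering_total Qord (tofrac f).
  by case: nsf; split=> //; apply: specialization_sub; rewrite rmorphN.
split=> // -[_ QNf]; apply: nsf.
rewrite (ordering_frac_anti (MkSpecr Qord) f) //.
by rewrite supp_specialization; exact: spec0.
Qed.

End Specialization.

Arguments specialization_ordering {Q} Qord Qcen.

Lemma central_prime_is_supp : is_central (ideal_of p) ->
  exists2 alpha, Specc A alpha & supp alpha = p.
Proof.
move=> cenp.
have [|Q Qord Qcen] := central_ordering_exists (T0 := @sum_squares _).
  by split=> //; exact: sum_squares_cone.
exists (MkSpecr (specialization_ordering Qord Qcen)).
  exact: specialization_central.
by apply: spec_inj; exact: supp_specialization.
Qed.

End CentralCones.

Theorem proposition3p15 (A : idomainType) (ratA : {rmorphism rat -> A}) :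
  (@supp A) @` (Specc A) = [set p : Spec A | is_central (ideal_of p)].
Proof.
apply/seteqP; split=> [_ [alpha ca <-]|p /central_prime_is_supp [alpha ca <-]].
  exact: supp_central_is_central.
by exists alpha.
Qed.
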